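(* Let $A$ be a finite dimensional algebra over a field $k$ such that the matrix algebra $M_n(A)$ is a Frobenius algebra for some positive integer $n$. Then $A$ is a Frobenius algebra.
   Context: A finite dimensional $k$-algebra $R$ is Frobenius if $R\simeq R^*$ as left $R$-modules, where $R^*=\mathrm{Hom}_k(R,k)$ with $(af)(x)=f(xa)$. *)

(* Defs.v *)
From HB Require Import structures.
From mathcomp Require Import all_boot all_order all_algebra all_field.

Set Implicit Arguments.
Unset Strict Implicit.
Unset Printing Implicit Defensive.

Import GRing.Theory.
Local Open Scope ring_scope.

(* R^* = Hom_k(R, k), with (a f)(x) = f (x a). This is an alias of            *)
(* 'Hom(R, k^o) because the latter already carries scaling by k.              *)
Definition dual (k : fieldType) (R : falgType k) : Type := 'Hom(R, k^o).

Section DualModule.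
Variables (k : fieldType) (R : falgType k).

HB.instance Definition _ := GRing.Zmodule.copy (dual R) 'Hom(R, k^o).

Definition dual_scale (a : R) (f : dual R) : dual R :=
  linfun (fun x : R => (f : 'Hom(R, k^o)) (x * a)).

Lemma dual_scaleE a (f : dual R) x :
  (dual_scale a f : 'Hom(R, k^o)) x = (f : 'Hom(R, k^o)) (x * a).
Proof.
have lin : linear (fun x : R => (f : 'Hom(R, k^o)) (x * a)).
  by move=> c u v; rewrite mulrDl -scalerAl linearP.
pose g : {linear R -> k^o} :=
  HB.pack (fun x : R => (f : 'Hom(R, k^o)) (x * a))
    (GRing.isLinear.Build k R k^o _ _ lin).
exact: (lfunE g x).
Qed.

Fact dual_scalerA a b f :
  dual_scale a (dual_scale b f) = dual_scale (a * b) f.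
Proof. by apply/lfunP => x; rewrite !dual_scaleE mulrA. Qed.

Fact dual_scale1r : left_id 1 dual_scale.
Proof. by move=> f; apply/lfunP => x; rewrite dual_scaleE mulr1. Qed.

Fact dual_scalerDr : right_distributive dual_scale +%R.
Proof.
move=> a f g; apply/lfunP => x.
by rewrite dual_scaleE [LHS]add_lfunE [RHS]add_lfunE !dual_scaleE.
Qed.

Fact dual_scalerDl f : {morph dual_scale^~ f : a b / a + b}.
Proof.
move=> a b; apply/lfunP => x.
by rewrite dual_scaleE [RHS]add_lfunE !dual_scaleE mulrDr linearD.
Qed.

HB.instance Definition _ := GRing.Zmodule_isLmodule.Build R (dual R)
  dual_scalerA dual_scale1r dual_scalerDr dual_scalerDl.

End DualModule.

(* R^o is R as a left module over itself. *)
Definition frobenius (k : fieldType) (R : falgType k) : Prop :=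
  exists phi : {linear R^o -> dual R}, bijective phi.

(* M_(n+1)(A) with scaling by k; the index n makes the size positive. The    *)
(* alias is needed because 'M[A]_n.+1 is canonically a module over A, not k.  *)
Definition mxalg (k : fieldType) (A : falgType k) (n : nat) : Type :=
  'M[A]_n.+1.

Section MatrixAlgebra.
Variables (k : fieldType) (A : falgType k) (n : nat).

HB.instance Definition _ := GRing.NzRing.copy (mxalg A n) 'M[A]_n.+1.

Definition mxalg_scale (c : k) (M : mxalg A n) : mxalg A n :=
  map_mx ( *:%R c) M.

Fact mxalg_scalerA a b M :
  mxalg_scale a (mxalg_scale b M) = mxalg_scale (a * b) M.
Proof. by apply/matrixP => i j; rewrite !mxE scalerA. Qed.

Fact mxalg_scale1r : left_id 1 mxalg_scale.
Proof. by move=> M; apply/matrixP => i j; rewrite !mxE scale1r. Qed.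

Fact mxalg_scalerDr : right_distributive mxalg_scale +%R.
Proof. by move=> c M N; apply/matrixP => i j; rewrite !mxE scalerDr. Qed.

Fact mxalg_scalerDl M : {morph mxalg_scale^~ M : a b / a + b}.
Proof. by move=> a b; apply/matrixP => i j; rewrite !mxE scalerDl. Qed.

HB.instance Definition _ := GRing.Zmodule_isLmodule.Build k (mxalg A n)
  mxalg_scalerA mxalg_scale1r mxalg_scalerDr mxalg_scalerDl.

Fact mxalg_scalerAl (c : k) (M N : mxalg A n) : c *: (M * N) = c *: M * N.
Proof.
apply/matrixP => i j; rewrite !mxE scaler_sumr.
by apply: eq_bigr => l _; rewrite !mxE scalerAl.
Qed.

HB.instance Definition _ := GRing.Lmodule_isLalgebra.Build k (mxalg A n)
  mxalg_scalerAl.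

Fact mxalg_scalerAr (c : k) (M N : mxalg A n) : c *: (M * N) = M * (c *: N).
Proof.
apply/matrixP => i j; rewrite !mxE scaler_sumr.
by apply: eq_bigr => l _; rewrite !mxE scalerAr.
Qed.

HB.instance Definition _ := GRing.Lalgebra_isAlgebra.Build k (mxalg A n)
  mxalg_scalerAr.

Import VectorInternalTheory.

Fact mxalg_vect_iso :
  SemiVector.axiom (dim {ffun 'I_n.+1 * 'I_n.+1 -> A}) (mxalg A n).
Proof.
pose V : vectType k := {ffun 'I_n.+1 * 'I_n.+1 -> A}.
pose toff (M : mxalg A n) : V := [ffun p => M p.1 p.2].
pose offf (f : V) : mxalg A n := \matrix_(i, j) f (i, j).
exists (fun M => v2r (toff M)).
  by split=> [c M|M N]; rewrite -semilinearP; congr v2r;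
    apply/ffunP=> p; rewrite !ffunE !mxE.
exists (fun r => offf (r2v r)) => [M|r].
  by rewrite v2rK; apply/matrixP=> i j; rewrite mxE ffunE.
by apply/(canLR r2vK)/ffunP=> -[i j]; rewrite ffunE mxE.
Qed.

HB.instance Definition _ := LSemiModule_hasFinDim.Build k (mxalg A n)
  mxalg_vect_iso.

HB.instance Definition _ := Algebra_isFalgebra.Build k (mxalg A n).

End MatrixAlgebra.

(* Main.v *)
From HB Require Import structures.
From Stdlib Require Import Classical.
Require Import Defs.
From mathcomp Require Import all_boot all_order all_algebra all_field.

(** Sending an isomorphism R -> R^* to the image f of 1 shows that R is
Frobenius exactly when some functional f on R has a kernel containing no nonzero
left ideal: the left R-linear map x |-> x f has as kernel the largest left ideal
on which f vanishes, here called the radical of f, and injectivity suffices for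
bijectivity because R and R^* have the same dimension ([frobeniusP]).

For such a functional on M_n(A), restricting along the first row of matrices
(a left A-module isomorphic to A^n) gives an embedding of A^n into (A^* )^n
([matrix_power_embedding]). It bounds the homomorphisms from a left ideal E to
A: Hom_A(E, A)^n embeds into Hom_A(E, A^* )^n, and Hom_A(E, A^* ) is the space
E^* of functionals on E, so dim Hom_A(E, A) <= dim E. If moreover f vanishes on
E and E is not 0, the map h |-> f h from Hom_A(E, A) to E^* kills the inclusion,
hence is not surjective ([ex_functional_not_lifting]).

This replaces an appeal to the Krull-Schmidt theorem. Let S be the left socle of
A and choose f on A with S :&: radical f of least dimension. If this left ideal
were not 0 it would contain a simple left ideal E; take a functional g on E that
is not of the form f h, and a projection pi of S onto E, which exists because
S is semisimple. Then f + g pi has a strictly smaller radical in S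
([radical_decrease]), a contradiction. So radical f meets S trivially, and
since every nonzero left ideal meets the socle, radical f = 0. *)

Set Implicit Arguments.
Unset Strict Implicit.
Unset Printing Implicit Defensive.

Import GRing.Theory.
Local Open Scope ring_scope.

(** * Extremal choices and linear algebra *)

Lemma ex_minimal (T : Type) (P : T -> Prop) (m : T -> nat) :
  (exists x, P x) -> exists2 x, P x & forall y, P y -> (m x <= m y)%N.
Proof.
case=> x Px; elim/ltn_ind: {x}(m x) {-2}x (leqnn (m x)) Px => b IH x mx Px.
have [[y Py lt_yx]|no] := classic (exists2 y, P y & (m y < m x)%N).
  by apply: (IH (m y) (leq_trans lt_yx mx) y).
exists x => // y Py; rewrite leqNgt; apply/negP => lt_yx.
by apply: no; exists y.
Qed.

Lemma subv_dim_ge (k : fieldType) (V : vectType k) (U W : {vspace V}) :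
  (U <= W)%VS -> (\dim W <= \dim U)%N -> (W <= U)%VS.
Proof. by move=> sUW; rewrite (geq_leqif (dimv_leqif_sup sUW)). Qed.

Lemma ex_max_vspace (k : fieldType) (V : vectType k) (P : {vspace V} -> Prop) :
  (exists U, P U) ->
  exists2 U, P U & forall W, P W -> (U <= W)%VS -> (W <= U)%VS.
Proof.
case/(ex_minimal (fun U => dim V - \dim U)%N) => U PU minU.
exists U => // W PW sUW.
have dW : (\dim W <= dim V)%N by rewrite -dimvf dimvS ?subvf.
by have := minU W PW; rewrite leq_sub2lE //; apply: subv_dim_ge.
Qed.

Lemma lker_neq0 (k : fieldType) (V W : vectType k) (f : 'Hom(V, W)) :
  (dim W < dim V)%N -> exists2 v, v != 0 & f v = 0.
Proof.
move=> ltWV; exists (vpick (lker f)); last first.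
  by apply/eqP; rewrite -memv_ker memv_pick.
rewrite vpick0; apply/eqP => ker0.
have := limg_ker_dim f fullv; rewrite ker0 capv0 dimv0 add0n dimvf => dV.
by have := dimvS (subvf (limg f)); rewrite dV dimvf leqNgt ltWV.
Qed.

Lemma daddv_pi0 (k : fieldType) (V : vectType k) (U W : {vspace V}) w :
  (U :&: W)%VS = 0%VS -> w \in W -> daddv_pi U W w = 0.
Proof.
move=> UW0 wW; have := daddv_pi_add UW0 (subvP (addvSr U W) _ wW).
by rewrite (@daddv_pi_id _ _ W) 1?capvC // -[RHS]add0r => /addIr.
Qed.

(** * The radical of a functional *)

Section Frobenius.
Variables (k : fieldType) (A : falgType k).
Implicit Types (a x : A) (U V C E S G : {vspace A}) (f g : 'Hom(A, k^o)).

(** The element x f of A^*, typed in 'Hom(A, k^o) so that it is a k-linear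
function of x. *)
Definition translate f (x : A) : 'Hom(A, k^o) := dual_scale x f.

Lemma translateE f x a : translate f x a = f (a * x).
Proof. exact: dual_scaleE. Qed.

Lemma translate_linear f : linear (translate f).
Proof.
move=> c x y; apply/lfunP => z.
by rewrite add_lfunE scale_lfunE !translateE mulrDr -scalerAr linearP.
Qed.

HB.instance Definition _ f := GRing.isLinear.Build k A 'Hom(A, k^o) _
  (translate f) (translate_linear f).

(** The largest left ideal contained in the kernel of f. *)
Definition radical f : {vspace A} := lker (linfun (translate f)).

Lemma radicalP f x : reflect (forall a, f (a * x) = 0) (x \in radical f).
Proof.
rewrite memv_ker lfunE /=; apply: (iffP eqP) => [fx0 a|fx0].
  by rewrite -translateE fx0 lfunE.
by apply/lfunP => a; rewrite translateE fx0 lfunE.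
Qed.

(** An A-linear map phi from A is determined by phi 1, and x f = 0 means that
f vanishes on A x, so radical f = 0 says that x |-> x f is injective; it is then
bijective since dim A^* = dim A. *)
Lemma frobeniusP : frobenius A <-> exists f, radical f = 0%VS.
Proof.
split=> [[phi phi_bij]|[f f_nd]].
  have phi1 (x : A) : phi x = x *: phi 1.
    by rewrite -linearZ; congr (phi _); rewrite -[LHS]mulr1.
  exists (phi 1 : 'Hom(A, k^o)); apply/eqP; rewrite -subv0.
  apply/subvP => x /radicalP x0; rewrite memv0; apply/eqP.
  apply: (bij_inj phi_bij); rewrite linear0 phi1; apply/lfunP => a.
  by rewrite [LHS]dual_scaleE x0 lfunE.
pose phi (x : A^o) : dual A := dual_scale (x : A) f.
have phi_lin : linear phi.
  by move=> c x y; rewrite /phi dual_scalerDl -dual_scalerA.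
pose phiL : {linear A^o -> dual A} :=
  HB.pack phi (GRing.isLinear.Build _ _ _ _ phi phi_lin).
pose F := linfun (translate f).
have FE x : F x = phi x by rewrite lfunE.
have F_surj : limg F = fullv.
  apply/eqP; rewrite eqEdim subvf /= limg_dim_eq; last first.
    by rewrite [lker F]f_nd capv0.
  by rewrite !dimvf /dim /= muln1.
exists phiL; exists F^-1%VF => x.
  by rewrite /= -FE lker0_lfunK // [lker F]f_nd.
by rewrite /= -FE limg_lfunVK // F_surj memvf.
Qed.

(** * Left ideals and the socle *)

Definition left_ideal U := forall a x, x \in U -> a * x \in U.

Definition simple_ideal E :=
  [/\ left_ideal E, E != 0%VS &
      forall U, left_ideal U -> (U <= E)%VS -> U != 0%VS -> (E <= U)%VS].

Lemma left_ideal0 : left_ideal 0%VS.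
Proof. by move=> a x; rewrite !memv0 => /eqP->; rewrite mulr0. Qed.

Lemma left_ideal_add U V :
  left_ideal U -> left_ideal V -> left_ideal (U + V)%VS.
Proof.
move=> lU lV a _ /memv_addP[u uU [v vV ->]].
by rewrite mulrDr memv_add ?lU ?lV.
Qed.

Lemma left_ideal_cap U V :
  left_ideal U -> left_ideal V -> left_ideal (U :&: V)%VS.
Proof. by move=> lU lV a x /memv_capP[xU xV]; rewrite memv_cap lU ?lV. Qed.

Lemma left_ideal_radical f : left_ideal (radical f).
Proof. by move=> a x /radicalP x0; apply/radicalP => b; rewrite mulrA x0. Qed.

Lemma left_ideal_principal x : left_ideal (limg (amulr x)).
Proof.
move=> a _ /memv_imgP[b _ ->]; rewrite lfunE /= mulrA.
by have := memv_img (amulr x) (memvf (a * b)); rewrite lfunE.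
Qed.

Lemma ex_simple_ideal U : left_ideal U -> U != 0%VS ->
  exists2 E, simple_ideal E & (E <= U)%VS.
Proof.
move=> lU U0.
pose P V := [/\ left_ideal V, V != 0%VS & (V <= U)%VS].
have [|E [lE E0 sEU] minE] := @ex_minimal _ P (fun V => \dim V).
  by exists U.
exists E => //; split=> // V lV sVE V0.
apply: subv_dim_ge => //; apply: minE.
by split=> //; apply: subv_trans sEU.
Qed.

Lemma simple_ideal_capP E U : simple_ideal E -> left_ideal U ->
  ~~ (E <= U)%VS -> (E :&: U)%VS = 0%VS.
Proof.
move=> [lE _ minE] lU; apply: contraNeq => EU0.
apply: subv_trans (minE _ _ (capvSl E U) EU0) (capvSr E U).
by apply: left_ideal_cap.
Qed.

(** S is the sum of the simple left ideals it contains, put as a density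
condition: no proper part of S contains all of them. In this form the condition
passes to sums at once. *)
Definition semisimple S := left_ideal S /\
  forall V, left_ideal V -> ~~ (S <= V)%VS ->
  exists2 E, simple_ideal E & (E <= S)%VS && ~~ (E <= V)%VS.

(** A semisimple left ideal S that is maximal for inclusion is the socle: for
simple E the sum S + E is again semisimple, hence equal to S. *)
Lemma ex_socle :
  exists2 S, semisimple S & forall E, simple_ideal E -> (E <= S)%VS.
Proof.
have [|S [lS ssS] maxS] := @ex_max_vspace _ _ semisimple.
  by exists 0%VS; split=> [|V _]; [apply: left_ideal0 | rewrite sub0v].
exists S => // E sE; have [lE _ _] := sE.
apply: subv_trans (addvSr S E) _; apply: maxS; last exact: addvSl.
split=> [|V lV]; first exact: left_ideal_add.
rewrite subv_add negb_and; case/orP=> [nSV|nEV].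
  have [F sF /andP[FS nFV]] := ssS V lV nSV.
  by exists F; rewrite // nFV (subv_trans FS) ?addvSl.
by exists E; rewrite // nEV addvSr.
Qed.

(** A left ideal C maximal among those that meet U trivially is a complement: a
simple E outside U + C could be added to C. *)
Lemma semisimple_complement S U : semisimple S -> left_ideal U ->
  exists2 C, left_ideal C & (U :&: C)%VS = 0%VS /\ (S <= U + C)%VS.
Proof.
move=> [_ ssS] lU.
pose P C := left_ideal C /\ (U :&: C)%VS = 0%VS.
have [|C [lC UC0] maxC] := @ex_max_vspace _ _ P.
  by exists 0%VS; split; [apply: left_ideal0 | rewrite capv0].
exists C => //; split=> //; apply/negPn/negP => nS.
have [E sE /andP[_ nE]] := ssS _ (left_ideal_add lU lC) nS.
have [lE _ _] := sE.
have E0 := simple_ideal_capP sE (left_ideal_add lU lC) nE.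
case/negP: nE; apply: subv_trans (addvSr U C).
apply: subv_trans (addvSr C E) _; apply: maxC (addvSl C E).
split; first exact: left_ideal_add.
apply/eqP; rewrite -subv0; apply/subvP.
move=> x /memv_capP[xU /memv_addP[c cC [e eE def_x]]].
move: xU; rewrite {x}def_x => ceU; have e0 : e = 0.
  apply/eqP; rewrite -memv0 -E0 memv_cap eE -(addKr c e) addrC.
  by rewrite memv_add ?memvN.
by rewrite e0 addr0 in ceU *; rewrite -UC0 memv_cap ceU.
Qed.

Lemma daddv_pi_mul U C a x : left_ideal U -> left_ideal C ->
  (U :&: C)%VS = 0%VS -> x \in (U + C)%VS ->
  daddv_pi U C (a * x) = a * daddv_pi U C x.
Proof.
move=> lU lC UC0 /memv_addP[u uU [c cC ->]].
have piD v d : v \in U -> d \in C -> daddv_pi U C (v + d) = v.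
  by move=> vU dC; rewrite linearD /= daddv_pi_id // daddv_pi0 // addr0.
by rewrite mulrDr !piD ?lU ?lC.
Qed.

(** * The dimension count *)

(** A homomorphism of left modules E -> A is represented by any k-linear
extension to A; only its values on E matter. *)
Definition hom_on E (h : 'End(A)) := forall a x, x \in E -> h (a * x) = a * h x.

(** Injectivity of the A-linear map A^n -> (A^* )^n that sends (x_j) to the
tuple with i-th entry \sum_j x_j (mu i j). *)
Definition power_embedding n (mu : 'I_n -> 'I_n -> 'Hom(A, k^o)) :=
  forall x : 'I_n -> A,
    (forall a i, \sum_j mu i j (a * x j) = 0) -> forall j, x j = 0.

(** Otherwise the inclusion of E, on which f vanishes, together with lifts of the
coordinate functionals for a basis of E gives dim E + 1 linearly independent
homomorphisms E -> A. With N = n.+1, the N-tuples of their combinations form a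
space of dimension (dim E + 1) N, which mu embeds into the N-tuples of
functionals on E, a space of dimension (dim E) N. *)
Lemma ex_functional_not_lifting n (mu : 'I_n.+1 -> 'I_n.+1 -> 'Hom(A, k^o)) E f :
    power_embedding mu -> left_ideal E -> E != 0%VS ->
    {in E, forall x, f x = 0} ->
  exists g : 'Hom(A, k^o),
    forall h, hom_on E h -> ~ {in E, forall x, f (h x) = g x}.
Proof.
move=> muP lE E0 fE0; apply: NNPP => no_g.
have liftE (g : 'Hom(A, k^o)) :
    exists h, hom_on E h /\ {in E, forall x, f (h x) = g x}.
  apply: NNPP => no_h; apply: no_g; exists g => h hE fh.
  by apply: no_h; exists h.
have [h' h'P] := fin_all_exists (fun i =>
  liftE (linfun (coord (vbasis E) i : A -> k^o))).
(* Index 0 is the inclusion of E; the others lift the coordinates. *)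
pose h (l : 'I_(\dim E).+1) : 'End(A) :=
  if unlift ord0 l is Some i then h' i else \1%VF.
have hE l : hom_on E (h l).
  rewrite /h; case: (unlift ord0 l) => [i|]; first by case: (h'P i).
  by move=> a x _; rewrite !lfunE.
pose comb (c : 'M[k]_((\dim E).+1, n.+1)) j : 'End(A) := \sum_l c l j *: h l.
pose F c i : 'Hom(A, k^o) := \sum_j (mu i j \o comb c j)%VF.
pose T c : 'M[k]_(\dim E, n.+1) := \matrix_(m, i) F c i (vbasis E)`_m.
have T_lin : linear T.
  have combD b c d j e : comb (b *: c + d) j e = b *: comb c j e + comb d j e.
    rewrite !sum_lfunE scaler_sumr -big_split; apply: eq_bigr => l _.
    by rewrite /= !scale_lfunE !mxE scalerDl scalerA.
  move=> b c d; apply/matrixP => m i; rewrite !mxE !sum_lfunE.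
  rewrite mulr_sumr -big_split.
  by apply: eq_bigr => j _; rewrite /= !comp_lfunE combD linearP.
pose TL : {linear _ -> _} := HB.pack T (GRing.isLinear.Build _ _ _ _ T T_lin).
have [|c c0 Tc0] := @lker_neq0 _ _ _ (linfun TL).
  by rewrite !dim_matrix ltn_pmul2r.
(* T only tests a basis of E, but F c i is linear. *)
have FE0 i : {in E, forall e, F c i e = 0}.
  move=> e eE; rewrite (coord_vbasis eE) linear_sum big1 // => m _.
  have := congr1 (fun M : 'M_(_, _) => M m i) Tc0.
  by rewrite lfunE /= !mxE linearZ /= => ->; rewrite scaler0.
have comb0 j : {in E, forall e, comb c j e = 0}.
  move=> e eE; apply: (muP (fun j => comb c j e)) => a i.
  rewrite -[RHS](FE0 i (a * e) (lE a e eE)) sum_lfunE; apply: eq_bigr => l _.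
  rewrite comp_lfunE; congr (mu i l _); rewrite !sum_lfunE mulr_sumr.
  by apply: eq_bigr => p _; rewrite !scale_lfunE hE // scalerAr.
(* f separates the lifts and kills the inclusion, so the coefficients of the
   lifts vanish first, and then that of the inclusion. *)
have clift0 m j : c (lift ord0 m) j = 0.
  have XE : (vbasis E)`_m \in E by rewrite vbasis_mem ?mem_nth ?size_tuple.
  have := congr1 f (comb0 j _ XE).
  have fhX p : f (h (lift ord0 p) (vbasis E)`_m) = (m == p)%:R.
    rewrite /h liftK (proj2 (h'P p)) // lfunE /=.
    by rewrite coord_free ?(basis_free (vbasisP E)).
  rewrite linear0 sum_lfunE big_ord_recl linearD /= /h unlift_none -/h.
  rewrite scale_lfunE id_lfunE linearZ /= fE0 // scaler0 add0r.
  rewrite linear_sum (bigD1 m) //=.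
  rewrite big1 ?addr0 => [|p pm]; rewrite scale_lfunE linearZ /= fhX.
    by rewrite eqxx => c0m; rewrite -[LHS]mulr1.
  by rewrite eq_sym (negPf pm) scaler0.
case/negP: c0; apply/eqP/matrixP => l j; rewrite mxE.
have [m ->|->] := unliftP ord0 l; first exact: clift0.
have := comb0 j _ (memv_pick E).
rewrite sum_lfunE big_ord_recl big1 ?addr0 => [|m _]; last first.
  by rewrite clift0 scale0r lfunE.
rewrite /h unlift_none scale_lfunE id_lfunE => /eqP.
by rewrite scaler_eq0 vpick0 (negPf E0) orbF => /eqP.
Qed.

(** * Decreasing the radical inside the socle *)

(** Let pi be the projection onto E along C, and f' = f + g pi. The point is that
pi s = 0 for every s in S :&: radical f'. If not, then A s maps onto the simple
ideal E, and by semisimplicity this surjection has a section t with values in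
A s; as f' vanishes on A s, f (t e) = - g (pi (t e)) = - g e, which makes g equal
to f (- t) on E. Hence S :&: radical f' lies in the kernel of pi, where f' agrees
with f; so it lies in S :&: radical f and misses E. *)
Lemma radical_decrease S E C f g :
    semisimple S -> simple_ideal E -> (E <= S)%VS -> (E <= radical f)%VS ->
    left_ideal C -> (E :&: C)%VS = 0%VS -> (S <= E + C)%VS ->
    (forall h, hom_on E h -> ~ {in E, forall x, f (h x) = g x}) ->
  (\dim (S :&: radical (f + (g \o daddv_pi E C)%VF)%R)
     < \dim (S :&: radical f))%N.
Proof.
move=> ssS sE sES sEf lC EC0 sSEC noh; set pi := daddv_pi E C; set f' := (f + _).
have [lS _] := ssS; have [lE E0 minE] := sE.
have f'E x : f' x = f x + g (pi x) by rewrite add_lfunE comp_lfunE.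
have piM a x : x \in S -> pi (a * x) = a * pi x.
  by move=> xS; rewrite /pi daddv_pi_mul // (subvP sSEC).
have key s : s \in S -> s \in radical f' -> pi s = 0.
  move=> sS /radicalP s0; apply/eqP/negP => /negP pis0.
  pose V := limg (amulr s); have lV : left_ideal V by apply: left_ideal_principal.
  have sV : s \in V.
    by have := memv_img (amulr s) (memvf 1); rewrite lfunE /= mul1r.
  have sVS : (V <= S)%VS.
    by apply/subvP => _ /memv_imgP[a _ ->]; rewrite lfunE /= lS.
  have [D lD [VCD0 sSVCD]] := semisimple_complement ssS (left_ideal_cap lV lC).
  (* A s = (A s :&: C) + G, so G lies in A s, misses C, and A s <= G + C. *)
  pose G := (V :&: D)%VS; have lG : left_ideal G by apply: left_ideal_cap.
  have GC0 : (G :&: C)%VS = 0%VS by rewrite -capvA (capvC D) capvA VCD0.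
  have sVGC : (V <= G + C)%VS.
    apply/subvP => v vV; have vS := subvP sVS _ vV.
    have /memv_addP[w wVC [d dD def_v]] := subvP sSVCD _ vS.
    have /memv_capP[wV wC] := wVC.
    rewrite def_v addrC memv_add // memv_cap dD andbT.
    by rewrite -(addKr w d) -def_v memvD ?memvN.
  have sEGC : (E <= G + C)%VS.
    have lGC := left_ideal_add lG lC.
    apply: contraR pis0 => nE; rewrite -memv0 -(simple_ideal_capP sE lGC nE).
    rewrite memv_cap memv_pi /=.
    have cGC : daddv_pi C E s \in (G + C)%VS.
      by apply: (subvP (addvSr G C)); apply: memv_pi.
    have -> : pi s = s - daddv_pi C E s.
      by rewrite -[X in X - _](daddv_pi_add EC0 (subvP sSEC _ sS)) addrK.
    by apply: memvB cGC; apply: (subvP sVGC).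
  (* The projection onto G along C, restricted to E, is the section t. *)
  apply: (noh (- daddv_pi G C)%VF) => [a x xE|e eE].
    by rewrite !opp_lfunE daddv_pi_mul ?mulrN // (subvP sEGC).
  have /memv_capP[/memv_imgP[a _ def_t] _] := memv_pi G C e.
  set t := daddv_pi G C e in def_t *.
  have te : pi t = e.
    have pi0 : pi (daddv_pi C G e) = 0.
      by apply: daddv_pi0 EC0 _; apply: memv_pi.
    have /(congr1 pi) := daddv_pi_add GC0 (subvP sEGC _ eE).
    by rewrite -/t linearD /= pi0 addr0 => ->; apply: daddv_pi_id.
  rewrite opp_lfunE linearN /= -/t; apply/eqP; rewrite eq_sym -addr_eq0 addrC.
  have := s0 a; rewrite f'E; rewrite lfunE /= in def_t; rewrite -def_t te => ->.
  by [].
have sK : (S :&: radical f' <= S :&: radical f)%VS.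
  apply/subvP => s /memv_capP[sS sf']; rewrite memv_cap sS /=.
  apply/radicalP => a; have := radicalP _ _ sf' a.
  by rewrite f'E piM // (key s) // mulr0 linear0 addr0.
rewrite ltnNge; apply: contra E0 => /(subv_dim_ge sK) eqK.
rewrite -subv0; apply/subvP => e eE.
have : e \in (S :&: radical f)%VS by rewrite memv_cap !(subvP sES, subvP sEf).
move/(subvP eqK)/memv_capP=> [[eS ef']]; rewrite memv0 -(key e) //.
by rewrite /pi daddv_pi_id.
Qed.

(** The least-dimensional choice of radical f inside the socle is 0; this settles
the whole radical, as a nonzero left ideal contains a simple one. *)
Lemma frobenius_of_power_embedding n (mu : 'I_n.+1 -> 'I_n.+1 -> 'Hom(A, k^o)) :
  power_embedding mu -> frobenius A.
Proof.
move=> muP; apply/frobeniusP.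
have [S ssS socS] := ex_socle; have [lS _] := ssS.
have [|f _ minf] := @ex_minimal _ (fun _ => True)
  (fun f => \dim (S :&: radical f)).
  by exists 0.
exists f; apply/eqP/negPn/negP => rf0.
have [E sE sEf] := ex_simple_ideal (@left_ideal_radical f) rf0.
have [lE E0 _] := sE.
have fE0 : {in E, forall x, f x = 0}.
  by move=> x /(subvP sEf)/radicalP/(_ 1); rewrite mul1r.
have [g noh] := ex_functional_not_lifting muP lE E0 fE0.
have [C lC [EC0 sSEC]] := semisimple_complement ssS lE.
have := radical_decrease ssS sE (socS E sE) sEf lC EC0 sSEC noh.
by rewrite ltnNge minf.
Qed.

End Frobenius.

(** * From matrices to powers *)

(** The coefficients mu i j of f are its restrictions to the matrices supported
at (i, j). If M has first row x and other rows 0, the i-th row of Y M is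
Y i 0 times x, so the hypothesis on x makes f vanish on all Y M and M is 0. *)
Lemma matrix_power_embedding (k : fieldType) (A : falgType k) n :
  frobenius (mxalg A n) ->
  exists mu : 'I_n.+1 -> 'I_n.+1 -> 'Hom(A, k^o), power_embedding mu.
Proof.
case/frobeniusP=> f f_nd.
pose d i j (a : A) : mxalg A n :=
  \matrix_(p, q) if (p == i) && (q == j) then a else 0.
have d_lin i j : linear (d i j).
  move=> c a b; apply/matrixP => p q; rewrite !mxE.
  by case: ifP; rewrite ?scaler0 ?addr0.
pose dL i j : {linear A -> mxalg A n} :=
  HB.pack (d i j) (GRing.isLinear.Build _ _ _ _ (d i j) (d_lin i j)).
pose mu i j : 'Hom(A, k^o) := (f \o linfun (dL i j))%VF.
exists mu => x mux0.
pose M : mxalg A n := \matrix_(p, q) if p == 0 then x q else 0.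
suff : M \in radical f.
  rewrite f_nd memv0 => /eqP M0 j.
  by have := congr1 (fun N : 'M_n.+1 => N 0 j) M0; rewrite !mxE.
apply/radicalP => Y.
have -> : Y * M = \sum_i \sum_j d i j (Y i 0 * x j).
  apply/matrixP => p q; rewrite !mxE summxE (bigD1 0) //=.
  rewrite big1 => [|l l0]; last first.
    by rewrite mxE (negPf l0) mulr0.
  rewrite (bigD1 p) //= [X in _ = _ + X]big1 => [|i ip]; last first.
    by rewrite summxE big1 // => j _; rewrite mxE eq_sym (negPf ip).
  rewrite summxE (bigD1 q) //= big1 => [|j jq]; last first.
    by rewrite mxE [q == j]eq_sym (negPf jq) andbF.
  by rewrite !mxE !eqxx !addr0.
rewrite linear_sum big1 // => i _; rewrite linear_sum -[RHS](mux0 (Y i 0) i).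
by apply: eq_bigr => j _; rewrite comp_lfunE lfunE.
Qed.

Theorem proposition7p2 (k : fieldType) (A : falgType k) :
  (exists n : nat, frobenius (mxalg A n)) -> frobenius A.
Proof.
by case=> n /matrix_power_embedding[mu]; apply: frobenius_of_power_embedding.
Qed.
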